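(* The complete locally convex space $\mathbb{R}^{\ell_2}$ (the product, with the product topology, of copies of $\mathbb{R}$ indexed by the elements of the set $\ell_2$ of square-summable real sequences) has the property $(MK)$ but does not have the property $(K)$.
   Context: A null sequence in a topological vector space (tvs) is a sequence converging to $0$. A null sequence $(x_n)_n$ in a tvs $E$ is a $K$-sequence if every subsequence of $(x_n)_n$ contains a subsequence $(y_n)_n$ such that the series $\sum_n y_n$ converges in $E$. A sequence $(x_n)_n$ in $E$ is Mackey null if there exists an increasing unbounded sequence $(a_n)_n$ of positive numbers such that $a_n x_n\to 0$ in $E$. $E$ has the property $(K)$ if every null sequence in $E$ is a $K$-sequence; $E$ has the property $(MK)$ if every Mackey null sequence in $E$ is a $K$-sequence. *)

(* Defs.v *)
From HB Require Import structures.
From mathcomp Require Import all_boot all_order all_algebra.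
From mathcomp Require Import all_classical all_reals all_analysis.

Set Implicit Arguments.
Unset Strict Implicit.
Unset Printing Implicit Defensive.

Import Order.TTheory GRing.Theory Num.Theory.
Import numFieldNormedType.Exports.

Local Open Scope classical_set_scope.
Local Open Scope ring_scope.

Section sequences_in_tvs.
Context (R : realType) (E : topologicalLmodType R).
Implicit Types x : E^nat.

Definition null_seq x := x @ \oo --> (0 : E).

(* [x \o s \o t] is a subsequence of the subsequence [x \o s] of [x]. *)
Definition K_seq x :=
  null_seq x /\
  forall s : nat^nat, increasing_seq s ->
  exists2 t : nat^nat, increasing_seq t &
  exists l : E, series (x \o s \o t) @ \oo --> l.

(* [increasing_seq] means strictly increasing; with nondecreasing [a] one gets
   the same notion, replacing [a n] by [a n * (1 - n.+2%:R^-1)]. *)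
Definition Mackey_null x :=
  exists a : R^nat, [/\ increasing_seq a, ~ has_ubound (range a),
    (forall n, 0 < a n) & null_seq (fun n => a n *: x n)].

Definition property_K := forall x, null_seq x -> K_seq x.

Definition property_MK := forall x, Mackey_null x -> K_seq x.

End sequences_in_tvs.

Arguments property_K {R} E.
Arguments property_MK {R} E.

(* Stated as a predicate because [completeType] bundles the property. *)
Definition complete_space (E : uniformType) :=
  forall F : set_system E, ProperFilter F -> cauchy F -> exists l : E, F --> l.

(* The power [V ^ I]: pointwise operations and product uniformity. *)
Definition power (I : Type) (V : Type) : Type := {ptws I -> V}.

HB.instance Definition _ (I : Type) (V : uniformType) :=
  Uniform.copy (power I V) {ptws I -> V}.

HB.instance Definition _ (I : Type) (V : zmodType) :=
  GRing.Zmodule.copy (power I V) (I -> V).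
HB.instance Definition _ (R : pzRingType) (I : Type) (V : lmodType R) :=
  (fct_lmodMixin I V : GRing.Zmodule_isLmodule R (power I V)).

Section power_tvs.
Context (R : numFieldType) (I : Type) (V : tvsType R).
Local Notation E := (power I V).

Lemma power_cvgP (F : set_system E) (f : E) : Filter F ->
  F --> f <-> forall i, (fun g : E => g i) @ F --> f i.
Proof.
move=> FF; split=> [Ff i A|Ff].
  rewrite nbhsE; move=> [W [oW Wfi] WA].
  have /cvg_sup/(_ i) := Ff; apply.
  exists ((fun g : forall _ : I, V => g i) @^-1` W).
  split => //; [by exists W|by move=> g /= /WA].
apply/cvg_sup => i A [_ [[W oW <-] Wfi WA]].
by apply: filterS WA _; apply: Ff; exact: open_nbhs_nbhs.
Qed.

Lemma power_proj_continuous i : continuous (fun g : E => g i).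
Proof. by move=> f; have [+ _] := @power_cvgP (nbhs f) f _; apply. Qed.

Let power_add_continuous : continuous (fun x : E * E => x.1 + x.2).
Proof.
move=> x; apply/power_cvgP => i.
suff h : (fun y : E * E => (y.1 i, y.2 i)) @ x --> (x.1 i, x.2 i).
  exact: (cvg_comp _ _ h (@add_continuous V (x.1 i, x.2 i))).
apply: cvg_pair => /=.
  have h : @fst E E @ x --> x.1 by exact: cvg_fst.
  exact: (cvg_comp _ _ h (@power_proj_continuous i x.1)).
have h : @snd E E @ x --> x.2 by exact: cvg_snd.
exact: (cvg_comp _ _ h (@power_proj_continuous i x.2)).
Qed.

Let power_scale_continuous : continuous (fun z : R^o * E => z.1 *: z.2).
Proof.
move=> x; apply/power_cvgP => i.
suff h : (fun y : R^o * E => (y.1, y.2 i)) @ x --> (x.1, x.2 i).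
  exact: (cvg_comp _ _ h (@scale_continuous R V (x.1, x.2 i))).
apply: (@cvg_pair _ _ _ _ (nbhs (x.1 : R^o))) => /=; first exact: cvg_fst.
have h : @snd R^o E @ x --> x.2 by exact: cvg_snd.
exact: (cvg_comp _ _ h (@power_proj_continuous i x.2)).
Qed.

Let power_locally_convex :
  exists2 B : set_system E, (forall b, b \in B -> convex_set b) & basis B.
Proof.
exists [set b : set E | open b /\ convex_set b] => [b /[!inE] -[]//|].
split=> [b []//|f].
have FF : Filter (filter_from [set b : set E | (open b /\ convex_set b) /\ b f] id).
  apply: filter_from_filter.
    by exists setT; split => //; split; [exact: openT|move=> ? ? ? _ _; rewrite inE].
  move=> b c [[bo bc] bf] [[co cc] cf]; exists (b `&` c) => //.
  split => //; split; first exact: openI.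
  move=> x y l; rewrite !in_setI => /andP[xb xc] /andP[yb yc].
  by rewrite bc// cc.
apply/power_cvgP => i A Afi.
have [B Bc [Bo Bn]] := @locally_convex R V.
have [b [Bb bfi] bA] := Bn (f i) _ Afi.
exists ((fun g : E => g i) @^-1` b); last by move=> g /= /bA.
split=> //; split.
  apply: open_comp; last exact: Bo.
  by move=> g _; exact: power_proj_continuous.
move=> x y l /[!inE] /= bx by_.
by apply/set_mem; apply: (Bc b _ (x i) (y i) l); rewrite inE.
Qed.

HB.instance Definition _ :=
  PreTopologicalNmodule_isTopologicalNmodule.Build E power_add_continuous.
HB.instance Definition _ :=
  TopologicalNmodule_isTopologicalLmodule.Build R E power_scale_continuous.
HB.instance Definition _ := Uniform_isTvs.Build R E power_locally_convex.

End power_tvs.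

Definition ell2 (R : realType) : Type :=
  [set u : R^nat | cvgn (series (fun n => u n ^+ 2))].

(* The library's [tvsType]s are the locally convex ones, so local convexity is
   part of the type. *)
Definition R_pow_ell2 (R : realType) : tvsType R := power (ell2 R) R^o.

(* Main.v *)
Require Import Defs.
From mathcomp Require Import all_boot all_order all_algebra.
From mathcomp Require Import all_classical all_reals all_analysis.
From mathcomp Require Import ring lra.

(** Everything in a power is decided coordinatewise, so completeness passes
from the reals to the power ([complete_power]).

The property (MK) holds in every power of a Banach space
([power_property_MK]): if [a n *: x n] tends to 0 with [a] increasing and
unbounded, a subsequence along which [a] dominates the powers of 2 does not
depend on the coordinate, and on each coordinate its terms are bounded by a
constant times [2 ^- k], so its series converges absolutely.

The property (K) fails for the coordinate functionals [e n : u |-> u n], which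
tend pointwise to 0 on the square-summable sequences.  Given any subsequence
[e (t k)], the sequence with the value [1 / (k + 1)] at each [t k] and 0
elsewhere ([spread t harmonic]) is square-summable, and evaluating the series
of the [e (t k)] at it gives the harmonic series, which diverges. *)

Set Implicit Arguments.
Unset Strict Implicit.
Unset Printing Implicit Defensive.

Import Order.TTheory GRing.Theory Num.Theory.
Import numFieldNormedType.Exports.

Local Open Scope classical_set_scope.
Local Open Scope ring_scope.

Lemma power_proj_unif_continuous (I : Type) (V : uniformType) (i : I) :
  unif_continuous (fun g : power I V => g i).
Proof.
move=> A entA.
suff : @entourage (power I V) ((fun xy => (xy.1 i, xy.2 i)) @^-1` A) by [].
(* The product uniformity is generated by the entourages of the initial
   uniformities of the projections, and this set is one of the generators. *)
rewrite /entourage /= /sup_ent /= smallest_filter_finI => F /= [_]; apply => /=.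
set E := _ @^-1` _.
have /asboolP entE : @entourage (initial_topology (fun g : power I V => g i))
    ((i : {classic I}), E).2.
  by exists A.
by exists (exist _ ((i : {classic I}), E) entE).
Qed.

(** A Cauchy filter projects to a Cauchy filter on every coordinate; the limits
of the projections, picked by choice, form the limit. *)
Lemma complete_power (R : numFieldType) (I : Type) (V : tvsType R) :
  complete_space V -> complete_space (power I V).
Proof.
move=> cV F FF Fcauchy.
have /choice[l Fl] i : exists l : V, (fun g : power I V => g i) @ F --> l.
  apply: cV => A entA; rewrite near_simpl -near2E near_map2.
  exact: (Fcauchy _ (power_proj_unif_continuous i entA)).
by exists l; exact/power_cvgP.
Qed.

Lemma power_seriesE (R : numFieldType) (I : Type) (V : tvsType R)
    (x : (power I V)^nat) (i : I) n :
  series x n i = series (x ^~ i) n.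
Proof. by rewrite /series/=; elim/big_rec2: _ => // k y1 y2 _ <-. Qed.

Lemma increasing_seq_ge_id (t : nat^nat) n : increasing_seq t -> (n <= t n)%N.
Proof.
move/increasing_seqP => tS; elim: n => // n IH.
exact: leq_ltn_trans IH (tS n).
Qed.

Lemma increasing_unbounded_cvgy (R : realType) (a : R^nat) :
  increasing_seq a -> ~ has_ubound (range a) -> a @ \oo --> +oo.
Proof.
move=> aI aoo; apply: nondecreasing_dvgn_lt => [n m|]; first by rewrite aI.
by move/cvg_seq_bounded/bounded_fun_has_ubound.
Qed.

Lemma cvgy_subseq_ge (R : realType) (b m : R^nat) : b @ \oo --> +oo ->
  exists2 t : nat^nat, increasing_seq t & forall k, m k <= b (t k).
Proof.
move=> boo.
have /choice[N Nb] k : exists N, forall n, (N <= n)%N -> m k <= b n.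
  by move/cvgryPge : boo => /(_ (m k))[N _ Nb]; exists N.
(* Partial sums of the [(N j).+1] increase strictly and exceed each [N k]. *)
exists (fun k => \sum_(j < k.+1) (N j).+1)%N.
  apply/increasing_seqP => k; rewrite [in ltRHS]big_ord_recr/= ltEnat/=.
  by rewrite addnS ltnS leq_addr.
by move=> k; apply: Nb; rewrite big_ord_recr/= addnS ltnW// ltnS leq_addl.
Qed.

(** One subsequence serves all coordinates because the weights [a], unlike the
rate at which [a n *: x n i] tends to 0, do not depend on [i]. *)
Lemma power_property_MK (R : realType) (I : Type) (V : completeNormedModType R) :
  property_MK (power I V).
Proof.
move=> x [a [aI aoo a_gt0 /power_cvgP ax0]].
have ay := increasing_unbounded_cvgy aI aoo.
have ainv0 : (fun n => (a n)^-1) @ \oo --> 0.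
  by apply/gtr0_cvgV0 => //; near=> n; exact: a_gt0.
have xE n i : x n i = (a n)^-1 *: (a n *: x n i).
  by rewrite scalerA mulVf ?scale1r// gt_eqF.
split.
  apply/power_cvgP => i.
  suff : (fun n => x n i) @ \oo --> (0 : V) by [].
  under eq_fun do rewrite xE.
  by rewrite -(scale0r (0 : V)); apply: cvgZ => //; exact: ax0.
move=> s sI.
have [t tI ta] := cvgy_subseq_ge (fun k => 2 ^+ k) ay.
have sta k : 2 ^+ k <= a (s (t k)).
  by rewrite (le_trans (ta k))// aI; exact: increasing_seq_ge_id.
exists t => //.
suff /choice[l xl] i :
    exists l : V, series ((x \o s \o t) ^~ i) @ \oo --> l.
  exists l; apply/power_cvgP => i.
  suff : (fun n => series (x \o s \o t) n i) @ \oo --> l i by [].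
  by under eq_fun do rewrite power_seriesE; exact: xl.
apply/cvg_ex; apply: normed_cvg.
have [M [_ M_ax]] : bounded_fun (fun n => a n *: x n i).
  by apply/cvg_seq_bounded/cvg_ex; exists 0; exact: ax0.
set C := `|M| + 1.
have ax_le n : `|a n *: x n i| <= C.
  by apply: M_ax => //; rewrite (le_lt_trans (ler_norm M))// ltrDl.
have C0 : 0 <= C by rewrite addr_ge0.
apply: (@series_le_cvg _ _ (geometric C 2^-1)) => [k|k|k|].
- exact: normr_ge0.
- by rewrite /= mulr_ge0// exprn_ge0.
- rewrite /= xE normrZ gtr0_norm ?invr_gt0// mulrC ler_pM ?ax_le//.
    by rewrite invr_ge0 ltW.
  by rewrite exprVn lef_pV2 ?posrE ?exprn_gt0 ?a_gt0//; exact: sta.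
- by apply: is_cvg_geometric_series; rewrite ger0_norm; lra.
Unshelve. all: by end_near. Qed.

(** The bound [2 - 1 / (n + 1)] on the sum of the first [n + 1] terms telescopes:
[1 / (n + 2) ^ 2] is at most [1 / (n + 1) - 1 / (n + 2)]. *)
Lemma cvg_series_harmonic_sqr (R : realType) :
  cvgn (series (fun k => harmonic k ^+ 2 : R)).
Proof.
apply: nondecreasing_is_cvgn.
  by apply: nondecreasing_series => k _ _; exact: sqr_ge0.
suff le2 n : series (fun k => harmonic k ^+ 2 : R) n.+1 <= 2 - n.+1%:R^-1.
  exists 2 => _ [[|n] _ <-]; first by rewrite /series/= big_geq.
  by rewrite (le_trans (le2 n))// lerBlDr lerDl invr_ge0.
rewrite /series/=; elim: n => [|n IH]; first by rewrite big_nat1; lra.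
have le_tel : (n.+2%:R^-1 : R) ^+ 2 <= n.+1%:R^-1 - n.+2%:R^-1.
  have -> : n.+1%:R^-1 - n.+2%:R^-1 = n.+1%:R^-1 * n.+2%:R^-1 :> R.
    have n0 : (0 : R) <= n%:R by rewrite ler0n.
    rewrite -[n.+2%:R]natr1 -[n.+1%:R]natr1; field.
    by rewrite !lt0r_neq0//; lra.
  by rewrite expr2 ler_wpM2r ?invr_ge0// lef_pV2 ?posrE// ?ler_nat.
by rewrite big_nat_recr//= (le_trans (lerD IH le_tel))// addrA subrK.
Qed.

(** For increasing [t], the sequence with the value [v k] at [t k] and 0 off the
range of [t].  The sum may stop at [n] since [t k = n] forces [k <= n]. *)
Definition spread (V : nmodType) (t : nat^nat) (v : V^nat) : V^nat :=
  fun n => \sum_(k < n.+1 | t k == n) v k.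

Lemma spread_val (V : nmodType) (t : nat^nat) (v : V^nat) k :
  increasing_seq t -> spread t v (t k) = v k.
Proof.
move=> tI; have kt : (k < (t k).+1)%N by rewrite ltnS increasing_seq_ge_id.
rewrite /spread (big_pred1 (Ordinal kt))// => j /=.
by rewrite (inj_eq (increasing_seq_injective tI)).
Qed.

Lemma spread_sqr (R : pzSemiRingType) (t : nat^nat) (v : R^nat) n :
  increasing_seq t -> spread t v n ^+ 2 = spread t (fun k => v k ^+ 2) n.
Proof.
move=> tI; have [[k <-]|tn] := pselect (exists k, t k = n).
  by rewrite !spread_val.
have tnF k : (t k == n) = false by apply/eqP => tk; apply: tn; exists k.
by rewrite /spread !big_pred0 ?expr0n// => k; exact: tnF.
Qed.

(** Exchanging the sums over [n] and [k], each [v k] with [k < N] is counted at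
most once, namely at [n = t k] when [t k < N]. *)
Lemma series_spread_le (R : numDomainType) (t : nat^nat) (v : R^nat) N :
  (forall k, 0 <= v k) -> series (spread t v) N <= series v N.
Proof.
move=> v0; rewrite /series/= !big_mkord.
have -> : \sum_(n < N) spread t v n =
    \sum_(n < N) \sum_(k < N | (t k == n) && (k < n.+1)%N) v k.
  apply: eq_bigr => n _.
  by rewrite /spread (big_ord_widen_cond N (fun k => t k == n) v).
rewrite (exchange_big_dep xpredT)//=; apply: ler_sum => k _.
have [[n /eqP tkn kn]|tk] :=
  pselect (exists2 n : 'I_N, t k == n & (k < n.+1)%N); last first.
  rewrite big_pred0// => n; apply/negP => /andP[? ?].
  by apply: tk; exists n.
rewrite (big_pred1 n)// => m /=; rewrite tkn eq_sym -val_eqE.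
by case: eqP => //= ->; rewrite kn.
Qed.

Lemma cvg_series_spread_harmonic_sqr (R : realType) (t : nat^nat) :
  increasing_seq t ->
  cvgn (series (fun n => spread t (harmonic : R^nat) n ^+ 2)).
Proof.
move=> tI; apply: nondecreasing_is_cvgn.
  by apply: nondecreasing_series => k _ _; exact: sqr_ge0.
have /cvg_seq_bounded/bounded_fun_has_ubound[M hM] :=
  @cvg_series_harmonic_sqr R.
exists M => _ [n _ <-].
apply: le_trans (hM (series (fun k => harmonic k ^+ 2) n) _); last by exists n.
under eq_fun do rewrite (spread_sqr _ _ tI).
by apply: series_spread_le => k; exact: sqr_ge0.
Qed.

Lemma ell2_cvg0 (R : realType) (u : ell2 R) : val u @ \oo --> 0.
Proof.
have /cvg_series_cvg_0 u20 := set_mem (valP u).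
apply/norm_cvg0P; under eq_fun do rewrite -sqrtr_sqr.
by rewrite -sqrtr0; apply: continuous_cvg => //; exact: sqrt_continuous.
Qed.

(** The whole sequence of coordinate functionals, as a subsequence of itself,
already has no further subsequence with convergent series. *)
Lemma R_pow_ell2_not_K (R : realType) : ~ property_K (R_pow_ell2 R).
Proof.
move=> K.
pose e n : R_pow_ell2 R := fun u => val u n.
have e0 : null_seq e by apply/power_cvgP => u; exact: ell2_cvg0.
have [_ /(_ id)[//|t tI [l /power_cvgP el]]] := K e e0.
pose u : ell2 R := exist _ (spread t harmonic)
  (@mem_set _ [set v : R^nat | cvgn (series (fun n => v n ^+ 2))] _
    (cvg_series_spread_harmonic_sqr tI)).
apply: (@dvg_harmonic R); apply/cvg_ex; exists (l u).
have : (fun n => series (e \o id \o t) n u) @ \oo --> l u by exact: el.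
under eq_fun do rewrite power_seriesE.
rewrite (_ : (_ \o _) ^~ u = harmonic)//.
by apply/funext => k; rewrite /= /e /= spread_val.
Qed.

Theorem mainTheorem5 (R : realType) :
  [/\ complete_space (R_pow_ell2 R),
      property_MK (R_pow_ell2 R) &
      ~ property_K (R_pow_ell2 R)].
Proof.
split.
- by apply: complete_power => F FF /cauchy_cvg Fc; exact/cvg_ex.
- exact: power_property_MK.
- exact: R_pow_ell2_not_K.
Qed.
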